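(* Let $G=\mathrm{GL}_{r+1}$ with Weyl group $W(G)\cong S_{r+1}$ generated by the simple reflections $s_1,\dots,s_r$. Let $$D=\{(k_1,\dots,k_r):k_i\in\mathbb{Z},\ 1\le k_i\le i+1\},$$ and for each $i$ set $\pi_{k_i}=s_is_{i-1}\cdots s_{k_i}$ if $1\le k_i\le i$, and $\pi_{k_i}=e$ (the identity) if $k_i=i+1$. Then the map $$\pi:D\to W(G),\qquad (k_1,\dots,k_r)\mapsto\pi_{k_1}\pi_{k_2}\cdots\pi_{k_r}$$ is a bijection. Moreover, $\pi(k_1,\dots,k_r)$ is reduced, i.e. the expression obtained by concatenating the words $s_is_{i-1}\cdots s_{k_i}$ for $i=1,\dots,r$ is a reduced expression.
   Context: The simple reflections carry the usual labeling: under $W(G)\cong S_{r+1}$, $s_i$ corresponds to the transposition $(i,i+1)$. The notation $\pi_{k_i}$ depends on the index $i$ as well as on the value $k_i$. *)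

(* Defs.v *)
From HB Require Import structures.
From mathcomp Require Import all_boot all_order all_algebra all_fingroup.
Set Implicit Arguments.
Unset Strict Implicit.
Unset Printing Implicit Defensive.
Import Order.TTheory GRing.Theory Num.Theory.
Local Open Scope ring_scope.

Section WeylGroup.
Variables (F : fieldType) (n : nat).

(* GL_n(F) is the predicate unitmx on 'M[F]_n. *)
Definition torus : {pred 'M[F]_n} := [pred t | (t \in unitmx) && is_diag_mx t].

Definition in_torus_normalizer (g : 'M[F]_n) : Prop :=
  g \in unitmx /\
  forall t : 'M[F]_n, (t \in torus) = (g *m t *m invmx g \in torus).

(* The quotient N(T)/T, described by its projection: W together with q is the
   Weyl group when q restricts to a surjective group morphism N(T) -> W with
   kernel T. Values of q outside N(T) are irrelevant. *)
Record weyl_group_of_GL (W : groupType) (q : 'M[F]_n -> W) : Prop := {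
  weyl_projM : forall g h, in_torus_normalizer g -> in_torus_normalizer h ->
    q (g *m h) = (q g * q h)%g;
  weyl_proj_ker : forall g, in_torus_normalizer g ->
    (q g = 1%g <-> g \in torus);
  weyl_proj_surj : forall w, exists2 g, in_torus_normalizer g & q g = w }.

End WeylGroup.

(* s_i (1 <= i <= r) is the class of the permutation matrix of the
   transposition (i, i+1) of {1, ..., r+1}; as 'I_r.+1 is {0, ..., r}, this
   transposition exchanges i.-1 and i. The argument i is meaningful only for
   1 <= i <= r. *)
Definition simple_reflection (F : fieldType) (r : nat) (W : groupType)
    (q : 'M[F]_r.+1 -> W) (i : nat) : W :=
  q (tperm_mx (inord i.-1) (inord i)).

Section Words.
Variables (W : groupType) (r : nat) (s : nat -> W).

Definition word_prod (v : seq nat) : W := (\prod_(i <- v) s i)%g.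

Definition reduced_expression (w : W) (v : seq nat) : Prop :=
  let letters u := all (fun i => 1 <= i <= r)%N u in
  [/\ letters v, word_prod v = w &
      forall v', letters v' -> word_prod v' = w -> (size v <= size v')%N].

(* The component tnth k i is k_{i+1} of the 1-based tuple (k_1, ..., k_r). *)
Definition D : {pred r.-tuple int} :=
  [pred k : r.-tuple int | [forall i : 'I_r, 1 <= tnth k i <= (i.+2)%:Z]].

(* The word i, i-1, ..., k if k <= i, and the empty word otherwise. *)
Definition pi_word (i : nat) (k : int) : seq nat :=
  if k <= i%:Z then rev (iota `|k|%N (i.+1 - `|k|)) else [::].

Definition pi_factor (i : nat) (k : int) : W := word_prod (pi_word i k).

Definition pi_map (k : r.-tuple int) : W :=
  (\prod_(i < r) pi_factor i.+1 (tnth k i))%g.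

Definition pi_full_word (k : r.-tuple int) : seq nat :=
  flatten [seq pi_word i.+1 (tnth k i) | i : 'I_r <- enum 'I_r].

End Words.

Arguments D r : clear implicits.

(* Main.v *)
(* Since F has an element a other than 0 and 1, conjugation of the torus by g
   forces a normalizing g to be monomial, so p |-> q (perm_mx p) is an
   isomorphism from the symmetric group onto W.
   In the symmetric group (acting on the right), the last factor
   s_m ... s_k of a product pi_{k_1} ... pi_{k_m} sends m to k - 1 while the
   others fix m (points numbered from 0): hence existence and uniqueness of
   the normal form by induction on m.
   By the Coxeter relations, multiplying a normal form on the right by s_j
   gives a normal form whose length grows by at most 1: either s_j changes k_m
   by 1, or it commutes past the last factor, becoming s_j or s_{j-1} and
   acting on the shorter product. So a word of length l has a normal form of
   length at most l, and uniqueness shows that normal forms are reduced. *)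
Require Import Defs.
From HB Require Import structures.
From mathcomp Require Import all_boot all_order all_algebra all_fingroup.
From mathcomp Require Import zify.
Set Implicit Arguments.
Unset Strict Implicit.
Unset Printing Implicit Defensive.
Import Order.TTheory GRing.Theory Num.Theory.
Local Open Scope ring_scope.

(** * Normal forms in a group satisfying the Coxeter relations of type A *)

Section NormalForms.
Local Open Scope nat_scope.
Local Open Scope group_scope.

Variables (W : groupType) (s : nat -> W).

(** At [k = i.+1] the word is empty, so both cases of the definition of $\pi_{k_i}$ are covered by
    one formula. *)
Definition desc (i k : nat) : W := word_prod s (rev (iota k (i.+1 - k))).

Definition normal_form (f : nat -> nat) (m : nat) : W :=
  \prod_(i < m) desc i.+1 (f i).

(** Indices are shifted: [f i] stands for $k_{i+1}$, hence the upper bound [i.+2]. *)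
Definition admissible (f : nat -> nat) (m : nat) : Prop :=
  forall i, i < m -> 1 <= f i <= i.+2.

Definition nf_length (f : nat -> nat) (m : nat) : nat :=
  (\sum_(i < m) (i.+2 - f i))%N.

Definition update (f : nat -> nat) (m k : nat) : nat -> nat :=
  fun i => if i == m then k else f i.

Lemma desc_nil i : desc i i.+1 = 1.
Proof. by rewrite /desc subnn /word_prod big_nil. Qed.

Lemma descS i k : k <= i -> desc i k = desc i k.+1 * s k.
Proof.
move=> le_ki; rewrite /desc subSn // subSS /= rev_cons /word_prod.
by rewrite -cats1 big_cat big_seq1.
Qed.

Lemma desc_ind i (P : nat -> Prop) :
  P i.+1 -> (forall k, k <= i -> P k.+1 -> P k) -> forall k, k <= i.+1 -> P k.
Proof.
move=> P0 PS k le_ki; move Ee: (i.+1 - k)%N => e.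
elim: e k le_ki Ee => [|e IHe] k le_ki Ee.
  by have -> : k = i.+1 by lia.
by apply: PS; [lia | apply: IHe; lia].
Qed.

Lemma normal_formS f m :
  normal_form f m.+1 = normal_form f m * desc m.+1 (f m).
Proof. by rewrite /normal_form big_ord_recr. Qed.

Lemma normal_form_update f m k :
  normal_form (update f m k) m.+1 = normal_form f m * desc m.+1 k.
Proof.
rewrite normal_formS {2}/update eqxx; congr (_ * _).
by apply: eq_bigr => i _; rewrite /update ltn_eqF.
Qed.

Lemma nf_length_update f m k :
  nf_length (update f m k) m.+1 = (nf_length f m + (m.+2 - k))%N.
Proof.
rewrite /nf_length big_ord_recr /= {2}/update eqxx; congr (_ + _)%N.
by apply: eq_bigr => i _; rewrite /update ltn_eqF.
Qed.

Lemma admissible_update f m k :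
  admissible f m -> 1 <= k <= m.+2 -> admissible (update f m k) m.+1.
Proof.
move=> fP kP i; rewrite /update ltnS leq_eqVlt.
by case: eqP => [-> //|_] /= /fP.
Qed.

Lemma word_prod_rcons v j : word_prod s (rcons v j) = word_prod s v * s j.
Proof. by rewrite /word_prod -cats1 big_cat big_seq1. Qed.

Variable r : nat.
Hypothesis s_invol : forall i, 1 <= i <= r -> s i * s i = 1.
Hypothesis s_comm : forall i j,
  1 <= i -> i.+1 < j <= r -> s i * s j = s j * s i.
Hypothesis s_braid : forall i, 1 <= i < r ->
  s i * s i.+1 * s i = s i.+1 * s i * s i.+1.

Lemma desc_comm i k j :
  i <= r -> 1 <= j -> j.+1 < k <= i.+1 -> desc i k * s j = s j * desc i k.
Proof.
move=> le_ir j_gt0 /andP[lt_jk le_ki]; move: k le_ki lt_jk.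
apply: desc_ind => [|k le_ki IHk] lt_jk; first by rewrite desc_nil mulg1 mul1g.
rewrite descS // -mulgA -s_comm //; last by lia.
by rewrite mulgA IHk ?mulgA //; lia.
Qed.

(** Moving left, $s_j$ passes the letters below $s_{j-1}$; the braid relation turns $s_js_{j-1}s_j$
    into $s_{j-1}s_js_{j-1}$, and the new $s_{j-1}$ passes the letters above $s_j$. *)
Lemma desc_shift i k j :
  i <= r -> 1 <= k -> k < j <= i -> desc i k * s j = s j.-1 * desc i k.
Proof.
move=> le_ir k_gt0 /andP[lt_kj le_ji].
have le_ki : k <= i.+1 by lia.
move: k le_ki k_gt0 lt_kj.
apply: desc_ind => [|k le_ki IHk] k_gt0 lt_kj; first by lia.
have [Ej|ltSkj] : j = k.+1 \/ k.+1 < j by lia.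
  rewrite Ej /= descS // descS; last by lia.
  rewrite -!mulgA [s k.+1 * _]mulgA -s_braid; last by lia.
  by rewrite !mulgA desc_comm //; lia.
rewrite descS // -mulgA s_comm //; last by lia.
by rewrite mulgA IHk ?mulgA //; lia.
Qed.

Lemma normal_form_mul m f j :
    m <= r -> admissible f m -> 1 <= j <= m ->
  exists2 f', admissible f' m &
    normal_form f' m = normal_form f m * s j /\
    nf_length f' m <= (nf_length f m).+1.
Proof.
elim: m f j => [|m IHm] f j le_mr fP jP; first by lia.
have fP' : admissible f m by move=> i lt_im; apply: fP; lia.
have fm := fP m (ltnSn m).
have lenS : nf_length f m.+1 = (nf_length f m + (m.+2 - f m))%N.
  by rewrite /nf_length big_ord_recr.
(* Once $s_j$ has crossed the last factor as $s_{j'}$, the first [m] factors absorb it by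
   induction. *)
have viaIH j' : 1 <= j' <= m ->
    desc m.+1 (f m) * s j = s j' * desc m.+1 (f m) ->
    exists2 f', admissible f' m.+1 &
      normal_form f' m.+1 = normal_form f m.+1 * s j /\
      nf_length f' m.+1 <= (nf_length f m.+1).+1.
  move=> j'P Ej; have [f' f'P [Ef' lef']] := IHm f j' (ltnW le_mr) fP' j'P.
  exists (update f' m (f m)); first exact: admissible_update.
  rewrite normal_form_update nf_length_update Ef' normal_formS lenS.
  by split; [rewrite -!mulgA Ej | lia].
(* In order: $s_j$ commutes with the last factor, extends it by a letter, cancels its final letter,
   or crosses it as $s_{j-1}$. *)
have [ltj|[Ej|[Ej|gtj]]] :
  j.+1 < f m \/ j.+1 = f m \/ j = f m \/ f m < j by lia.
- by apply: (viaIH j); [lia | apply: desc_comm => //; lia].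
- exists (update f m j); first by apply: admissible_update => //; lia.
  rewrite normal_form_update nf_length_update normal_formS lenS -Ej.
  by split; [rewrite descS ?mulgA //; lia | lia].
- exists (update f m j.+1); first by apply: admissible_update => //; lia.
  rewrite normal_form_update nf_length_update normal_formS lenS -Ej.
  split; last by lia.
  by rewrite (@descS _ j) -?mulgA ?s_invol ?mulg1 //; lia.
- by apply: (viaIH j.-1); [lia | apply: desc_shift => //; lia].
Qed.

Lemma word_normal_form v :
    all (fun i => 1 <= i <= r) v ->
  exists2 f, admissible f r &
    normal_form f r = word_prod s v /\ nf_length f r <= size v.
Proof.
elim/last_ind: v => [|v j IHv].
  (* The values $k_i=i+1$ make every factor empty. *)
  exists (fun i => i.+2) => [i|]; first by rewrite leqnn.
  rewrite /normal_form /nf_length /word_prod big_nil !big1 // => i _.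
    by rewrite subnn.
  exact: desc_nil.
rewrite all_rcons => /andP[jP /IHv[f fP [Ef lef]]].
have [f' f'P [Ef' lef']] := normal_form_mul (leqnn r) fP jP.
exists f' => //; rewrite Ef' Ef word_prod_rcons size_rcons; split=> //; lia.
Qed.

End NormalForms.

(** * Existence and uniqueness of normal forms in the symmetric group *)

Section Symmetric.
Local Open Scope nat_scope.
Local Open Scope group_scope.
Variable r : nat.

(** Points are numbered from 0, exactly as in [simple_reflection], so that $s_i$ is by definition
    the class of the matrix of [adj i]. *)
Definition adj (i : nat) : 'S_r.+1 := tperm (inord i.-1) (inord i).

Lemma inord_eq (i j : nat) : i <= r -> j <= r ->
  (inord i == inord j :> 'I_r.+1) = (i == j).
Proof. by move=> iP jP; rewrite -val_eqE /= !inordK. Qed.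

Lemma adj_invol i : adj i * adj i = 1.
Proof. exact: tperm2. Qed.

Lemma adj_comm i j : 1 <= i -> i.+1 < j <= r -> adj i * adj j = adj j * adj i.
Proof.
move=> i_gt0 ijP; rewrite [RHS]conjgC /conjg; congr (_ * _).
rewrite -/(_ ^ _) tpermJ /adj !tpermD // inord_eq; lia.
Qed.

Lemma adj_braid i : 1 <= i < r ->
  adj i * adj i.+1 * adj i = adj i.+1 * adj i * adj i.+1.
Proof.
(* Both sides are conjugates equal to the transposition of [i.-1] and [i.+1]. *)
move=> iP; transitivity (adj i.+1 ^ adj i).
  by rewrite /conjg tpermV mulgA.
transitivity (adj i ^ adj i.+1); last by rewrite /conjg tpermV mulgA.
rewrite /adj /= !tpermJ tpermR tpermL !tpermD // inord_eq; lia.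
Qed.

Lemma desc_adj_fix i k (x : 'I_r.+1) :
  1 <= k -> k <= i.+1 -> i < x -> desc adj i k x = x.
Proof.
move=> k_gt0 le_ki lt_ix; move: k le_ki k_gt0.
apply: desc_ind => [|k le_ki IHk] k_gt0; first by rewrite desc_nil perm1.
have x_le := ltn_ord x.
rewrite descS // permM IHk // -[x]inord_val /adj tpermD // inord_eq; lia.
Qed.

Lemma desc_adj_top i k :
  i <= r -> 1 <= k -> k <= i.+1 -> desc adj i k (inord i) = inord k.-1.
Proof.
move=> le_ir k_gt0 le_ki; move: k le_ki k_gt0.
apply: desc_ind => [|k le_ki IHk] k_gt0; first by rewrite desc_nil perm1.
by rewrite descS // permM IHk //= tpermR.
Qed.

Lemma normal_form_adj_fix f m (x : 'I_r.+1) :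
  admissible f m -> m < x -> normal_form adj f m x = x.
Proof.
elim: m => [|m IHm] fP lt_mx; first by rewrite /normal_form big_ord0 perm1.
have fm := fP m (ltnSn m).
rewrite normal_formS permM IHm ?desc_adj_fix //; try lia.
by move=> i lt_im; apply: fP; lia.
Qed.

Lemma normal_form_adj_inj f g m :
    m <= r -> admissible f m -> admissible g m ->
    normal_form adj f m = normal_form adj g m ->
  forall i, i < m -> f i = g i.
Proof.
elim: m => [//|m IHm] le_mr fP gP.
have fP' : admissible f m by move=> i lt_im; apply: fP; lia.
have gP' : admissible g m by move=> i lt_im; apply: gP; lia.
have fm := fP m (ltnSn m); have gm := gP m (ltnSn m).
rewrite !normal_formS => Efg.
have Em : f m = g m.
  (* The first [m] factors fix the point [m.+1], and the last one sends it to [(f m).-1], which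
     determines [f m]. *)
  have := congr1 (fun p : 'S_r.+1 => p (inord m.+1)) Efg.
  rewrite !permM !normal_form_adj_fix ?inordK //; try lia.
  rewrite !desc_adj_top //; try lia.
  by move/eqP; rewrite inord_eq; lia.
move: Efg; rewrite Em => /mulIg Efg i; rewrite ltnS leq_eqVlt.
by case/orP=> [/eqP->//|]; apply: IHm => //; lia.
Qed.

Lemma normal_form_adj_exists m (p : 'S_r.+1) :
    m <= r -> (forall x : 'I_r.+1, m < x -> p x = x) ->
  exists2 f, admissible f m & normal_form adj f m = p.
Proof.
elim: m p => [|m IHm] p le_mr pP.
  (* A permutation fixing every point but 0 also fixes 0; any function serves for the empty
     product. *)
  exists id => //; rewrite /normal_form big_ord0; apply/permP => x.
  rewrite perm1; have [x_gt0|] := ltnP 0 x; first by rewrite pP.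
  rewrite leqn0 => /eqP x0; have [px_gt0|] := ltnP 0 (p x).
    exact/esym/(@perm_inj _ p)/pP.
  by rewrite leqn0 => /eqP px0; apply: val_inj; rewrite /= x0 px0.
set y := p (inord m.+1).
have le_ym : y <= m.+1.
  rewrite leqNgt; apply/negP => lt_my.
  have /perm_inj Ey := pP y lt_my.
  by move: lt_my; rewrite Ey inordK // ltnn.
(* The factor with $k=y+1$ sends [m.+1] to [y], just as [p] does, so dividing by it leaves a
   permutation that fixes [m.+1] too. *)
have [x|f fP Ef] := IHm (p * (desc adj m.+1 y.+1)^-1) (ltnW le_mr).
  rewrite leq_eqVlt => /orP[/eqP Ex|lt_mx]; rewrite permM.
    have -> : x = inord m.+1 by apply: val_inj; rewrite /= inordK.
    apply: (@perm_inj _ (desc adj m.+1 y.+1)).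
    by rewrite permKV desc_adj_top //= inord_val.
  by rewrite pP // -{1}(@desc_adj_fix m.+1 y.+1 x) // permK.
exists (update f m y.+1); first exact: admissible_update.
by rewrite normal_form_update Ef mulgKV.
Qed.

End Symmetric.

(** * The normalizer of the diagonal torus consists of monomial matrices *)

Section WeylGroup.
Variables (F : fieldType) (r : nat).
Implicit Types (g t : 'M[F]_r.+1) (p : 'S_r.+1).

Lemma torus_diagP t :
  reflect (t \in unitmx /\ exists d, t = diag_mx d) (t \in @torus F r.+1).
Proof. by apply: (iffP andP) => -[t_unit /diag_mxP]. Qed.

Lemma invmx_perm p : invmx (perm_mx p) = perm_mx p^-1 :> 'M[F]_r.+1.
Proof. by rewrite perm_mxV. Qed.

(** Diagonal matrices commute, so conjugating the diagonal matrix $txt^{-1}$ back by $t$ leaves it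
    unchanged: it is $x$ itself. *)
Lemma torus_conj_torus t x :
    t \in @torus F r.+1 -> t *m x *m invmx t \in @torus F r.+1 ->
  x \in @torus F r.+1.
Proof.
case/torus_diagP=> t_unit [d Et] /torus_diagP[x_unit [e Ex]].
suff -> : x = diag_mx e.
  by rewrite -Ex; apply/torus_diagP; split=> //; exists e.
have := congr1 (fun y => invmx t *m (y *m t)) Ex.
by rewrite mulmxKV // mulKmx // [in RHS]Et diag_mxC -Et mulKmx.
Qed.

Lemma torus_in_torus_normalizer t :
  t \in @torus F r.+1 -> in_torus_normalizer t.
Proof.
move=> tT; have /torus_diagP[t_unit [d Et]] := tT.
split=> // x; apply/idP/idP; last exact: torus_conj_torus.
move=> xT; have /torus_diagP[_ [e Ex]] := xT.
by rewrite {1}Et {1}Ex diag_mxC -Et -Ex mulmxK.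
Qed.

Lemma torus_conj_perm p t : t \in @torus F r.+1 ->
  perm_mx p *m t *m perm_mx p^-1 \in @torus F r.+1.
Proof.
case/andP=> t_unit /is_diag_mxP t_diag; apply/andP; split.
  by rewrite !unitmx_mul !unitmx_perm t_unit.
apply/is_diag_mxP => i j ne_ij; rewrite -row_permE -col_permE !mxE.
by apply: t_diag; rewrite (inj_eq val_inj) (inj_eq perm_inj).
Qed.

Lemma perm_in_torus_normalizer p : in_torus_normalizer (perm_mx p : 'M[F]_r.+1).
Proof.
split=> [|t]; first exact: unitmx_perm.
rewrite invmx_perm; apply/idP/idP; first exact: torus_conj_perm.
move/(torus_conj_perm p^-1); rewrite invgK !mulmxA -perm_mxM mulVg perm_mx1.
by rewrite mul1mx -mulmxA -perm_mxM mulVg perm_mx1 mulmx1.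
Qed.

(** The entry of [perm_mx p] at [(i, p i)] is 1, hence must lie on the diagonal. *)
Lemma perm_in_torus p : (perm_mx p : 'M[F]_r.+1) \in @torus F r.+1 -> p = 1%g.
Proof.
case/andP=> _ /is_diag_mxP p_diag; apply/permP => i; rewrite perm1.
apply/eqP/negPn/negP; rewrite eq_sym => /p_diag/eqP.
by rewrite !mxE eqxx oner_eq0.
Qed.

(* Conjugating diag(1, ..., a, ..., 1) shows that g E_ii g^-1 is diagonal, so
   that every nonzero entry of column i of g is alone in its row. *)
Lemma torus_normalizer_row (a : F) g : a != 0 -> a != 1 ->
    in_torus_normalizer g ->
  forall i j k, g j i != 0 -> k != i -> g j k = 0.
Proof.
move=> a0 a1 [g_unit gT] i j k gji ne_ki.
pose d : 'rV[F]_r.+1 := \row_l (if l == i then a else 1).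
have dT : diag_mx d \in @torus F r.+1.
  apply/torus_diagP; split; last by exists d.
  rewrite unitmxE det_diag unitfE; apply/prodf_neq0 => l _.
  by rewrite mxE; case: ifP; rewrite ?oner_neq0.
move: dT; rewrite gT => /torus_diagP[_ [e Ee]].
have {}Ee : g *m diag_mx d = diag_mx e *m g by rewrite -Ee mulmxKV.
have ej l : g j l * d 0 l = e 0 j * g j l.
  have := congr1 (fun M : 'M_r.+1 => M j l) Ee.
  by rewrite mul_mx_diag mul_diag_mx !mxE.
have Eea : e 0 j = a.
  by apply/(mulIf gji); rewrite -ej mxE eqxx mulrC.
have := ej k; rewrite Eea mxE (negPf ne_ki) mulr1 => /eqP.
rewrite -{1}[g j k]mul1r -subr_eq0 -mulrBl mulf_eq0 subr_eq0 eq_sym (negPf a1).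
by move/eqP.
Qed.

Lemma torus_normalizer_monomial (a : F) g : a != 0 -> a != 1 ->
    in_torus_normalizer g ->
  exists2 t, t \in @torus F r.+1 & exists p, g = t *m perm_mx p.
Proof.
move=> a0 a1 gN; have row_g := torus_normalizer_row a0 a1 gN.
have [g_unit _] := gN.
(* A zero column would make the determinant vanish. *)
have col_g i : exists j, g j i != 0.
  apply/existsP; rewrite -[[exists _, _]]negbK negb_exists.
  apply/negP => /forallP gi0; move: g_unit.
  rewrite unitmxE (expand_det_col _ i) big1 ?unitr0 // => j _.
  by have := gi0 j; rewrite negbK => /eqP->; rewrite mul0r.
(* [f i] is the row of a nonzero entry of column [i]; two columns cannot share it, since that entry
   is alone in its row. *)
pose f i := xchoose (col_g i); have gf i : g (f i) i != 0 := xchooseP (col_g i).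
have f_inj : injective f.
  move=> i i' Ef; apply/eqP/negPn/negP => ne_ii'.
  by have := gf i; rewrite (row_g i' (f i)) ?eqxx // Ef.
pose p := perm f_inj; pose d : 'rV[F]_r.+1 := \row_j g j (p^-1%g j).
have Eg : g = diag_mx d *m perm_mx p^-1.
  apply/matrixP => j l; rewrite mul_diag_mx !mxE.
  case: eqVneq => [->|ne_jl]; first by rewrite mulr1.
  rewrite mulr0; apply: (row_g (p^-1%g j)); last by rewrite eq_sym.
  by have := gf (p^-1%g j); rewrite -[f _](permE f_inj) permKV.
exists (diag_mx d); last by exists p^-1%g.
apply/torus_diagP; split; last by exists d.
by move: g_unit; rewrite Eg unitmx_mul => /andP[].
Qed.

End WeylGroup.

(** * The isomorphism from the symmetric group onto the Weyl group *)

Section WeylIsomorphism.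
Variables (F : fieldType) (r : nat) (W : groupType) (q : 'M[F]_r.+1 -> W).
Hypothesis hW : weyl_group_of_GL q.

Lemma weyl_permM :
  {morph (fun p : 'S_r.+1 => q (perm_mx p)) : p p' / (p * p')%g}.
Proof.
move=> p p' /=; rewrite perm_mxM.
by rewrite (weyl_projM hW) //; apply: perm_in_torus_normalizer.
Qed.

Lemma weyl_perm1 : q (perm_mx 1) = 1%g.
Proof. by apply: (@mulgI _ (q (perm_mx 1))); rewrite -weyl_permM !mulg1. Qed.

(** The kernel is the torus, whose only permutation matrix is the identity. *)
Lemma weyl_perm_inj : injective (fun p : 'S_r.+1 => q (perm_mx p)).
Proof.
move=> p p' Eq; apply: (mulIg p'^-1%g); rewrite mulgV.
apply/perm_in_torus/(weyl_proj_ker hW); first exact: perm_in_torus_normalizer.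
by rewrite weyl_permM /= Eq -weyl_permM mulgV weyl_perm1.
Qed.

Lemma weyl_perm_surj (a : F) (w : W) : a != 0 -> a != 1 ->
  exists p : 'S_r.+1, q (perm_mx p) = w.
Proof.
move=> a0 a1; have [g gN <-] := weyl_proj_surj hW w.
have [t tT [p ->]] := torus_normalizer_monomial a0 a1 gN.
have tN := torus_in_torus_normalizer tT.
exists p; rewrite (weyl_projM hW) //; last exact: perm_in_torus_normalizer.
by rewrite (weyl_proj_ker hW tN).2 // mul1g.
Qed.

Lemma word_prod_weyl v :
  word_prod (simple_reflection q) v = q (perm_mx (word_prod (@adj r) v)).
Proof.
by rewrite /word_prod (big_morph _ weyl_permM weyl_perm1).
Qed.

End WeylIsomorphism.

(** * Translation between integer tuples in $D$ and admissible functions *)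

Section TupleCode.
Variable r : nat.

(** On [D r] all entries are positive, so [absz] loses nothing there. *)
Definition tuple_fun (k : r.-tuple int) (i : nat) : nat := absz (nth 0 k i).

Definition fun_tuple (f : nat -> nat) : r.-tuple int :=
  [tuple (f i)%:Z | i < r].

Lemma mem_DP (k : r.-tuple int) :
  reflect (forall i : 'I_r, 1 <= tnth k i <= (i.+2)%:Z) (k \in D r).
Proof. exact: forallP. Qed.

Lemma tuple_funE k (i : 'I_r) : tuple_fun k i = `|tnth k i|%N.
Proof. by rewrite /tuple_fun -tnth_nth. Qed.

Lemma tuple_fun_admissible k : k \in D r -> admissible (tuple_fun k) r.
Proof.
move/mem_DP=> kP i lt_ir; have := kP (Ordinal lt_ir).
by rewrite -[i]/(val (Ordinal lt_ir)) tuple_funE /=; lia.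
Qed.

Lemma fun_tuple_in_D f : admissible f r -> fun_tuple f \in D r.
Proof.
move=> fP; apply/mem_DP => i; have := fP i (ltn_ord i).
by rewrite tnth_mktuple; lia.
Qed.

Lemma fun_tupleK f (i : 'I_r) : tuple_fun (fun_tuple f) i = f i.
Proof. by rewrite tuple_funE tnth_mktuple. Qed.

Lemma pi_wordE k (i : 'I_r) : k \in D r ->
  pi_word i.+1 (tnth k i) =
    rev (iota (tuple_fun k i) (i.+2 - tuple_fun k i)).
Proof.
move/mem_DP/(_ i) => kP; rewrite tuple_funE /pi_word; case: ifP => // gt_k.
by have -> : (i.+2 - `|tnth k i| = 0)%N by lia.
Qed.

Lemma pi_mapE (W : groupType) (s : nat -> W) k : k \in D r ->
  pi_map s k = normal_form s (tuple_fun k) r.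
Proof.
by move=> kD; apply: eq_bigr => i _; rewrite /pi_factor pi_wordE.
Qed.

Lemma word_prod_pi_full_word (W : groupType) (s : nat -> W) (k : r.-tuple int) :
  word_prod s (pi_full_word k) = pi_map s k.
Proof.
rewrite /word_prod big_flatten big_map.
by rewrite /pi_map [index_enum _]unlock enumT.
Qed.

Lemma size_pi_full_word k : k \in D r ->
  size (pi_full_word k) = nf_length (tuple_fun k) r.
Proof.
move=> kD; rewrite size_flatten /shape sumnE 2!big_map big_enum.
by apply: eq_bigr => i _; rewrite pi_wordE // size_rev size_iota.
Qed.

Lemma letters_pi_full_word k : k \in D r ->
  all (fun i => 1 <= i <= r)%N (pi_full_word k).
Proof.
move=> kD; apply/allP => j /flatten_mapP[i _]; rewrite pi_wordE //.
rewrite mem_rev mem_iota.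
by have := tuple_fun_admissible kD (ltn_ord i); have := ltn_ord i; lia.
Qed.

Lemma pi_map_adj_inj : {in D r &, injective (pi_map (@adj r))}.
Proof.
move=> k k' kD k'D; rewrite !pi_mapE // => Ekk'.
apply: eq_from_tnth => i.
have := normal_form_adj_inj (leqnn r) (tuple_fun_admissible kD)
  (tuple_fun_admissible k'D) Ekk' (ltn_ord i).
rewrite !tuple_funE.
by have /mem_DP/(_ i) := kD; have /mem_DP/(_ i) := k'D; lia.
Qed.

Lemma pi_map_fun_tuple (W : groupType) (s : nat -> W) f : admissible f r ->
  pi_map s (fun_tuple f) = normal_form s f r.
Proof.
move=> fP; rewrite pi_mapE ?fun_tuple_in_D //.
by apply: eq_bigr => i _; rewrite fun_tupleK.
Qed.

Lemma pi_map_adj_surj (p : 'S_r.+1) :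
  exists2 k, k \in D r & pi_map (@adj r) k = p.
Proof.
(* The fixed-point condition is vacuous: no point of ['I_r.+1] exceeds [r]. *)
have [x lt_rx|f fP Ef] := @normal_form_adj_exists r r p (leqnn r).
  by have := ltn_ord x; lia.
by exists (fun_tuple f); rewrite ?fun_tuple_in_D // pi_map_fun_tuple.
Qed.

Lemma pi_full_word_adj_minimal (k : r.-tuple int) v : k \in D r ->
    all (fun i => 1 <= i <= r)%N v ->
    word_prod (@adj r) v = pi_map (@adj r) k ->
  (size (pi_full_word k) <= size v)%N.
Proof.
move=> kD vP Ev.
have [f fP [Ef lef]] := word_normal_form (fun i _ => adj_invol r i)
  (@adj_comm r) (@adj_braid r) vP.
rewrite size_pi_full_word //.
(* The normal form obtained from [v] represents the same permutation as [k], so by uniqueness the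
   two have equal lengths. *)
suff -> : nf_length (tuple_fun k) r = nf_length f r by [].
apply: eq_bigr => i _; congr (_ - _)%N.
apply: (normal_form_adj_inj (leqnn r)) (ltn_ord i) => //.
  exact: tuple_fun_admissible.
by rewrite Ef Ev pi_mapE.
Qed.

End TupleCode.

Theorem proposition1p4 (F : fieldType) (hF : exists2 a : F, a != 0 & a != 1)
    (r : nat) (W : groupType) (q : 'M[F]_r.+1 -> W)
    (hW : weyl_group_of_GL q) :
  let s := simple_reflection q in
  [/\ {in D r &, injective (pi_map s)},
      (forall w : W, exists2 k : r.-tuple int, k \in D r & pi_map s k = w) &
      forall k : r.-tuple int, k \in D r ->
        reduced_expression r s (pi_map s k) (pi_full_word k)].
Proof.
move=> s; have [a a0 a1] := hF.
(* The map into [W] factors through the symmetric group, where all three claims are already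
   established. *)
have pi_mapW (k : r.-tuple int) : pi_map s k = q (perm_mx (pi_map (@adj r) k)).
  by rewrite -!word_prod_pi_full_word (word_prod_weyl hW).
split=> [k k' kD k'D | w | k kD].
- by rewrite !pi_mapW => /(weyl_perm_inj hW); apply: pi_map_adj_inj.
- have [p <-] := weyl_perm_surj hW w a0 a1.
  by have [k kD <-] := pi_map_adj_surj p; exists k; rewrite ?pi_mapW.
split; [exact: letters_pi_full_word | exact: word_prod_pi_full_word |].
move=> v vP; rewrite pi_mapW (word_prod_weyl hW) => /(weyl_perm_inj hW).
exact: pi_full_word_adj_minimal.
Qed.
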